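(* Let $N\to\infty$, $M\to\infty$ and let the sets $\mathcal K_{NM}\subset\{1,\dots,N\}\times\{1,\dots,M\}$ satisfy $$\sup_{(n,m)\in\mathcal K_{NM}}\left(\frac1n+\frac1m+\frac nN+\frac mM\right)\to0$$ and $$\sup_{(n,m)\in\mathcal K_{NM}}\left(\frac{\log N}{n\log(p^{-1})}+\frac{\log M}{m\log(q^{-1})}\right)\to0,$$ where $p=n/N$, $q=m/M$. Let $\mathbf a=\mathbf a_{NM}=\{a_{nm}>0:(n,m)\in\mathcal K_{NM}\}$ be such that at least one of the following conditions holds: $$\text{(i)}\quad \min_{(n,m)\in\mathcal K_{NM}}a_{nm}^2nmpq\to\infty,\qquad\text{or}\qquad\text{(ii)}\quad \liminf\min_{(n,m)\in\mathcal K_{NM}}\frac{a_{nm}^2nm}{2\left(n\log(p^{-1})+m\log(q^{-1})\right)}>1 .$$ Then the test $\psi^*_{NM}=\max\{\psi^{\mathrm{lin}}_H,\psi^{\max}_{NM}\}$, with $H=H_{NM}\to\infty$ chosen such that moreover $H\le c\min_{(n,m)\in\mathcal K_{NM}}a_{nm}\sqrt{nmpq}$ for some constant $0<c<1$ when (i) holds, satisfies $\gamma_{NM,\mathbf a}(\psi^*_{NM})\to0$.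
   Context: Model: one observes an $N\times M$ matrix $\mathbf Y=\{Y_{ij}\}$, $Y_{ij}=s_{ij}+\xi_{ij}$, with $\xi_{ij}$ i.i.d. standard Gaussian and $s_{ij}\in\mathbb R$. $P_S$, $E_S$ denote probability and expectation when the mean matrix is $S=\{s_{ij}\}$; $E_0$ corresponds to $S=0$ (null hypothesis). All limits are as $N\to\infty$, $M\to\infty$. The sets $\mathcal K_{NM}$ are (nonempty) sets of possible submatrix sizes; $p=n/N$ and $q=m/M$ depend on $(n,m)$. $\mathcal C_{nm}$ is the collection of all sets $C=A\times B$ with $A\subset\{1,\dots,N\}$, $\#A=n$, $B\subset\{1,\dots,M\}$, $\#B=m$; $G_{nm}=\#\mathcal C_{nm}=\binom Nn\binom Mm$. $\mathcal S_{nm,a}$ is the set of matrices $S$ for which there is $C\in\mathcal C_{nm}$ with $s_{ij}=0$ for $(i,j)\notin C$ and $s_{ij}\ge a$ for $(i,j)\in C$. The combined alternative is $\mathcal S_{NM,\mathbf a}=\bigcup_{(n,m)\in\mathcal K_{NM}}\mathcal S_{nm,a_{nm}}$. For a test (measurable function) $\psi=\psi(\mathbf Y)\in[0,1]$, $\gamma_{NM,\mathbf a}(\psi)=E_0\psi+\sup_{S\in\mathcal S_{NM,\mathbf a}}E_S(1-\psi)$. Tests: $t_{\mathrm{lin}}=\frac1{\sqrt{NM}}\sum_{i,j}Y_{ij}$, $\psi^{\mathrm{lin}}_H=\mathbf 1_{\{t_{\mathrm{lin}}>H\}}$; for $C\in\mathcal C_{nm}$, $Y_C=\frac1{\sqrt{nm}}\sum_{(i,j)\in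 C}Y_{ij}$; $V_{nm}=\sqrt{2\log(NM\,G_{nm})}$, $t_{NM,\max}=\max_{(n,m)\in\mathcal K_{NM}}\max_{C\in\mathcal C_{nm}}Y_C/V_{nm}$, $\psi^{\max}_{NM}=\mathbf 1_{\{t_{NM,\max}>1\}}$. *)

(* Defs.v *)
From HB Require Import structures.
From mathcomp Require Import all_boot all_order all_algebra.
From mathcomp Require Import all_classical all_reals all_analysis.

Set Implicit Arguments.
Unset Strict Implicit.
Unset Printing Implicit Defensive.

Import Order.TTheory GRing.Theory Num.Theory.
Import numFieldNormedType.Exports.

Local Open Scope classical_set_scope.
Local Open Scope ring_scope.

Section Submatrices.
Variables N M : nat.

Definition rects (n m : nat) : {set {set 'I_N * 'I_M}} :=
  [set finset.setX A B | A in [set A : {set 'I_N} | #|A| == n],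
                         B in [set B : {set 'I_M} | #|B| == m]]%SET.

Variable R : realType.

Definition alt_nm (n m : nat) (a : R) : set 'M[R]_(N, M) :=
  [set S | exists2 C, C \in rects n m &
     forall i j, ((i, j) \notin C -> S i j = 0) /\
                 ((i, j) \in C -> a <= S i j)].

Definition alt (K : set (nat * nat)) (a : nat -> nat -> R) :
    set 'M[R]_(N, M) :=
  \bigcup_(nm in K) alt_nm nm.1 nm.2 (a nm.1 nm.2).

(* K is finite and nonempty wherever supK and infK are used, so these are the
   maximum and the minimum over K. *)
Definition supK (K : set (nat * nat)) (f : nat -> nat -> \bar R) : \bar R :=
  ereal_sup [set f nm.1 nm.2 | nm in K].

Definition infK (K : set (nat * nat)) (f : nat -> nat -> \bar R) : \bar R :=
  ereal_inf [set f nm.1 nm.2 | nm in K].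

Implicit Type Y : 'M[R]_(N, M).

Definition t_lin Y : R :=
  (\sum_(i < N) \sum_(j < M) Y i j) / Num.sqrt (N%:R * M%:R).

Definition psi_lin (H : R) Y : R := (H < t_lin Y)%R%:R.

Definition Ysum (n m : nat) (C : {set 'I_N * 'I_M}) Y : R :=
  (\sum_(c in C) Y c.1 c.2) / Num.sqrt (n%:R * m%:R).

Definition V (n m : nat) : R :=
  Num.sqrt (2 * ln (N%:R * M%:R * #|rects n m|%:R)).

Definition t_max (K : set (nat * nat)) Y : \bar R :=
  supK K (fun n m =>
    \big[maxe/-oo%E]_(C in rects n m) (Ysum n m C Y / V n m)%:E).

Definition psi_max (K : set (nat * nat)) Y : R := (1 < t_max K Y)%E%:R.

Definition psi_star (K : set (nat * nat)) (H : R) Y : R :=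
  Num.max (psi_lin H Y) (psi_max K Y).

End Submatrices.

Section Noise.
Variables (R : realType) (N M : nat).
Variables (d : measure_display) (T : measurableType d) (P : probability T R).
Variable xi : 'I_N -> 'I_M -> {RV P >-> R}.

Definition mutually_independent : Prop :=
  forall (J : {set 'I_N * 'I_M}) (B : 'I_N * 'I_M -> set R),
    (forall c, measurable (B c)) ->
    P (\bigcap_(c in [set` J]) (xi c.1 c.2 @^-1` B c)) =
    (\prod_(c in J) P (xi c.1 c.2 @^-1` B c))%E.

Definition iid_std_gaussian : Prop :=
  (forall i j (B : set R), measurable B ->
     distribution P (xi i j) B = normal_prob 0 1 B) /\
  mutually_independent.

(* E_S psi, through the representation Y = S + xi of the observation. *)
Definition expect (S : 'M[R]_(N, M)) (psi : 'M[R]_(N, M) -> R) : \bar R :=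
  'E_P[fun w => psi (S + \matrix_(i, j) xi i j w)%R]%E.

Definition risk (A : set 'M[R]_(N, M)) (psi : 'M[R]_(N, M) -> R) : \bar R :=
  (expect 0 psi + ereal_sup [set expect S (fun Y => (1 - psi Y)%R) | S in A])%E.

End Noise.

Section Conditions.
Variables (R : realType) (F : set_system (nat * nat)).
Variables (K : nat -> nat -> set (nat * nat)) (a : nat -> nat -> nat -> nat -> R).

Definition relsize (n N : nat) : R := n%:R / N%:R.

Definition cond_i : Prop :=
  infK (K NM.1 NM.2) (fun n m =>
    (a NM.1 NM.2 n m ^+ 2 * n%:R * m%:R * relsize n NM.1 * relsize m NM.2)%:E)
  @[NM --> F] --> +oo%E.

Definition cond_ii : Prop :=
  (1 < limf_einf (fun NM : nat * nat =>
    infK (K NM.1 NM.2) (fun n m =>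
      (a NM.1 NM.2 n m ^+ 2 * n%:R * m%:R /
       (2 * (n%:R * ln ((relsize n NM.1)^-1) + m%:R * ln ((relsize m NM.2)^-1))))%:E))
    F)%E.

End Conditions.

(* Main.v *)
Require Import Defs.
From HB Require Import structures.
From mathcomp Require Import all_boot all_order all_algebra.
From mathcomp Require Import all_classical all_reals all_analysis.
From mathcomp Require Import measurable_realfun ring lra.
Import Order.TTheory GRing.Theory Num.Theory.
Import numFieldNormedType.Exports.
Local Open Scope classical_set_scope.
Local Open Scope ring_scope.

(* Every indicator occurring in the risk is bounded pointwise by exponentials of
   linear forms in Y, whose expectations are explicit Gaussian exponential
   moments; in particular no measurability of the tests is needed.

   Null hypothesis: the linear test contributes exp(-H^2/2).  Since
   exp(-V_nm^2/2) = 1/(NM G_nm), the union bound over all submatrices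
   contributes #K/(NM), which is at most sup n/N and tends to 0.

   Alternatives: t_lin and Y_C are unit linear forms, of mean at least
   a sqrt(nmpq) and a sqrt(nm).  Under (i) the first exceeds H by at least
   (1/c - 1) H.  Under (ii), binom(N,n) <= (eN/n)^n and the two size conditions
   give V_nm^2 <= 2 (1 + o(1)) (n log(1/p) + m log(1/q)), so that the second
   exceeds V_nm by at least eps V_nm, and V_nm^2 >= 2 log N. *)

(** * Integration of a composition against a density *)

Section comp_density.
Import HBNNSimple.

(** The hypothesis says that the image under [X] of the measure with density [g] is [c] times [nu].
    Linearity extends it from indicators to simple functions, monotone convergence to nonnegative
    measurable [f]. It serves to split one factor off an independent product and to integrate
    against the normal density. *)
Lemma integral_comp_density (R : realType) d d' (T : measurableType d)
    (T' : measurableType d') (mu : {measure set T -> \bar R})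
    (nu : {measure set T' -> \bar R}) (X : T -> T') (g : T -> R) (c : R) :
  measurable_fun setT X -> measurable_fun setT g -> (forall t, 0 <= g t) ->
  0 <= c ->
  (forall B, measurable B ->
     \int[mu]_t ((\1_B (X t) * g t)%R)%:E = c%:E * nu B)%E ->
  forall f : T' -> R, measurable_fun setT f -> (forall x, 0 <= f x) ->
  (\int[mu]_t ((f (X t) * g t)%R)%:E = c%:E * \int[nu]_x (f x)%:E)%E.
Proof.
move=> mX mg g0 c0 HB f mf f0.
have mf' : measurable_fun [set: T'] (EFin \o f) by exact/measurable_EFinP.
pose h := nnsfun_approx measurableT mf'.
have hf x : (EFin \o h ^~ x) @ \oo --> (f x)%:E.
  by apply: (cvg_nnsfun_approx measurableT mf') => // y _; rewrite lee_fin.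
have ndh x : nondecreasing_seq (fun n => (h n x)%:E).
  by move=> m n mn; rewrite lee_fin; exact/lefP/nd_nnsfun_approx.
have hgf t : ((h n (X t) * g t)%:E @[n --> \oo]) --> (f (X t) * g t)%:E.
  under eq_fun do rewrite EFinM.
  by rewrite EFinM; apply: cvgeZr => //; exact: hf.
have ndhg t : nondecreasing_seq (fun n => (h n (X t) * g t)%:E).
  move=> m n mn; rewrite lee_fin ler_wpM2r//; have := ndh (X t) m n mn.
  by rewrite lee_fin.
have mX1 B : measurable B -> measurable_fun [set: T] (fun t => \1_B (X t) * g t).
  by move=> mB; apply: measurable_funM => //; apply: measurableT_comp.
have mh n : measurable_fun [set: T] (fun t => (h n (X t) * g t)%:E).
  by apply/measurable_EFinP; apply: measurable_funM => //; apply: measurableT_comp.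
transitivity (limn (fun n => \int[mu]_t ((h n (X t) * g t)%R)%:E))%E.
  rewrite -monotone_convergence//; last by move=> *; rewrite lee_fin mulr_ge0.
  by apply: eq_integral => t _; apply/esym/cvg_lim => //; exact: hgf.
rewrite -ge0_integralZl//; last by move=> x _; rewrite lee_fin.
transitivity (limn (fun n => \int[nu]_x (c%:E * (h n x)%:E)))%E; last first.
  rewrite -monotone_convergence//=.
  - apply: eq_integral => t _; apply/cvg_lim => //; apply: cvgeZl => //.
    exact: hf.
  - by move=> n; apply: measurable_funeM; exact/measurable_EFinP.
  - by move=> n x _; rewrite mule_ge0// lee_fin.
  - by move=> x _ m n mn; rewrite lee_wpmul2l ?lee_fin//; exact: ndh.
(* It remains to treat the simple function [h n], as a finite sum over its values. *)
congr (limn _); apply/funext => n.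
rewrite ge0_integralZl//; last by move=> x _; rewrite lee_fin.
  2: exact/measurable_EFinP.
rewrite integralT_nnsfun sintegralE.
rewrite ge0_mule_fsumr; last first.
  by move=> r; exact: nnsfun_mulemu_ge0.
transitivity (\sum_(k \in range (h n))
    \int[mu]_x (k * (\1_(h n @^-1` [set k]) (X x) * g x))%:E)%E.
  rewrite -ge0_integral_fsum//.
  - apply: eq_integral => t _; rewrite fsumEFin//; congr EFin.
    rewrite {1}fimfunE mulr_fsuml.
    by apply: eq_fsbigr => r _; rewrite mulrA.
  - by move=> y; apply/measurable_EFinP; apply: measurable_funM => //; exact: mX1.
  - move=> y x _; rewrite mulrA EFinM mule_ge0 ?lee_fin//.
    by have := nnfun_muleindic_ge0 (h n) y (X x); rewrite lee_fin.
apply: eq_fsbigr => r /set_mem [x _ rx].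
under eq_integral do rewrite EFinM.
rewrite ge0_integralZl//.
- by rewrite HB// muleCA.
- by apply/measurable_EFinP; exact: mX1.
- by move=> t _; rewrite lee_fin mulr_ge0.
- by rewrite lee_fin -rx.
Qed.

End comp_density.

(** The integral of a nonnegative function is a supremum over the simple functions below it, and a
    larger function admits more of them. *)
Lemma ge0_le_integral_nonmeasurable (R : realType) d (T : measurableType d)
    (mu : {measure set T -> \bar R}) (f g : T -> \bar R) :
  (forall t, 0 <= f t)%E -> (forall t, f t <= g t)%E ->
  (\int[mu]_t f t <= \int[mu]_t g t)%E.
Proof.
move=> f0 fg; rewrite !ge0_integralTE//; last first.
  by move=> t; exact: le_trans (fg t).
apply: le_ereal_sup => _ [h hf <-]; exists h => // t.
exact: le_trans (fg t).
Qed.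

(** * Independent products and Gaussian exponential moments *)

Section gauss.
Context (R : realType).

Lemma expectation_prod_indep d (T : measurableType d) (P : probability T R)
    (I : finType) (X : I -> {RV P >-> R}) :
  (forall B : I -> set R, (forall c, measurable (B c)) ->
     P (\bigcap_c (X c @^-1` B c)) = \prod_c P (X c @^-1` B c))%E ->
  forall (f : I -> R -> R) (e : I -> R),
  (forall c, measurable_fun setT (f c)) -> (forall c x, 0 <= f c x) ->
  (forall c, \int[P]_t (f c (X c t))%:E = (e c)%:E)%E ->
  (\int[P]_t (\prod_c f c (X c t))%:E = (\prod_c e c)%:E)%E.
Proof.
move=> indep f e mf f0 ef.
(* Induction on the set s of coordinates whose function is not an indicator;
   integral_comp_density passes from an indicator to a general function. *)
suff H (s : seq I) (f' : I -> R -> R) (e' : I -> R) :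
    (forall c, measurable_fun setT (f' c)) -> (forall c x, 0 <= f' c x) ->
    (forall c, \int[P]_t (f' c (X c t))%:E = (e' c)%:E)%E ->
    (forall c, c \notin s -> exists2 B, measurable B & f' c = \1_B) ->
    (\int[P]_t (\prod_c f' c (X c t))%:E = (\prod_c e' c)%:E)%E.
  by apply: (H (enum I)) => // c; rewrite mem_enum.
elim: s f' e' => [|x s IH] g u mg g0 gu gB.
  (* Base case: every factor is an indicator, so the product is the indicator of an intersection and
     independence applies directly. *)
  have {gB} /choice[B gB] : forall c, exists B, measurable B /\ g c = \1_B.
    by move=> c; have [//|B mB ->] := gB c; exists B.
  under eq_integral => t _.
    have -> : \prod_c g c (X c t) = \1_(\bigcap_c (X c @^-1` B c)) t.
      have [tB|tB] := pselect ((\bigcap_c (X c @^-1` B c)) t).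
        rewrite indicE mem_set// big1// => c _.
        by rewrite (gB c).2 indicE mem_set//; exact: tB.
      have /existsNP[c /not_implyP[_ tc]] := tB.
      rewrite indicE memNset// (bigD1 c)//= (gB c).2 indicE memNset// mul0r//.
    over.
  have mB : measurable (\bigcap_c (X c @^-1` B c)).
    apply: fin_bigcap_measurable => [|c _]; first exact: finite_finset.
    rewrite -[X in measurable X]setTI; apply: measurable_funPT => //.
    exact: (gB c).1.
  rewrite integral_indic// setIT.
  transitivity (\prod_c P (X c @^-1` B c))%E.
    by apply: indep => c; exact: (gB c).1.
  rewrite -prodEFin; apply: eq_bigr => c _; rewrite -gu (gB c).2.
  rewrite [RHS](_ : _ = \int[P]_t (\1_(X c @^-1` B c) t)%:E)%E//.
  rewrite integral_indic// ?setIT//.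
  rewrite -[X in measurable X]setTI; apply: measurable_funPT => //.
    exact: (gB c).1.
have u0 c : 0 <= u c.
  by rewrite -lee_fin -gu; apply: integral_ge0 => t _; rewrite lee_fin.
have [xs|xs] := boolP (x \in s).
  apply: IH => // c cs; apply: gB; rewrite inE negb_or cs andbT.
  by apply: contraNneq cs => ->.
(* The product [G] of the other factors acts as the density, so that only indicators at the
   coordinate [x] remain to be checked. *)
pose G t := \prod_(c | c != x) g c (X c t).
have mG : measurable_fun setT G.
  rewrite /G; under eq_fun do rewrite -big_filter.
  by apply: measurable_prod => c _; apply: measurableT_comp.
rewrite (bigD1 x)//= mulrC EFinM -[X in (_ * X)%E]gu.
rewrite -(ge0_integral_distribution (X x) (f := EFin \o g x))//=; last 2 first.
- exact/measurable_EFinP.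
- by move=> y; rewrite lee_fin.
rewrite -(@integral_comp_density _ _ _ _ _ P (distribution P (X x)) (X x) G)//.
- by apply: eq_integral => t _; rewrite (bigD1 x).
- by move=> t; apply: prodr_ge0 => c _.
- exact: prodr_ge0.
move=> B mB.
pose g' c := if c == x then \1_B else g c.
have mXB : measurable (X x @^-1` B).
  by rewrite -[X in measurable X]setTI; apply: measurable_funPT.
pose u' c := if c == x then fine (P (X x @^-1` B)) else u c.
transitivity ((\prod_c u' c)%:E).
  rewrite -(IH g').
  - apply: eq_integral => t _; rewrite (bigD1 x)//= /g' eqxx.
    by congr ((_ * _)%:E); apply: eq_bigr => c /negbTE ->.
  - by rewrite /g' => c; case: ifP.
  - by rewrite /g' => c y; case: ifP.
  - rewrite /g' /u' => c; case: eqVneq => [->|_]; last exact: gu.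
    rewrite fineK ?fin_num_measure//.
    rewrite [LHS](_ : _ = \int[P]_t (\1_(X x @^-1` B) t)%:E)%E//.
    by rewrite integral_indic// setIT.
  - move=> c cs; rewrite /g'; case: eqVneq => cx; first by exists B.
    by apply: gB; rewrite inE negb_or cx.
rewrite (bigD1 x)//= /u' eqxx mulrC EFinM fineK ?fin_num_measure//.
by congr (_%:E * _)%E; apply: eq_bigr => c /negbTE ->.
Qed.

(** Completing the square: [expR (w * x)] times the standard normal density is [expR (w ^+ 2 / 2)]
    times the normal density of mean [w], which integrates to 1. *)
Lemma integral_normal_expR (nu : {measure set R -> \bar R}) (w : R) :
  (forall B, measurable B -> nu B = normal_prob 0 1 B) ->
  (\int[nu]_x (expR (w * x))%:E = (expR (w ^+ 2 / 2))%:E)%E.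
Proof.
move=> nuE.
have -> : (\int[nu]_x (expR (w * x))%:E =
    \int[lebesgue_measure]_x ((expR (w * x) * normal_pdf 0 1 x)%R)%:E)%E.
  rewrite -[LHS]mul1e -(@integral_comp_density _ _ _ _ _ lebesgue_measure
    nu idfun (normal_pdf 0 1) 1)//=.
  - exact: measurable_id.
  - exact: measurable_normal_pdf.
  - exact: normal_pdf_ge0.
  - move=> B mB; rewrite mul1e nuE// /normal_prob [RHS]integral_mkcond/=.
    apply: eq_integral => x _; rewrite patchE indicE.
    by case: ifP; rewrite ?mul1r ?mul0r.
  - by apply: measurableT_comp => //; exact: measurable_funM.
transitivity (\int[lebesgue_measure]_x
    ((expR (w ^+ 2 / 2))%:E * (normal_pdf w 1 x)%:E))%E.
  apply: eq_integral => x _; rewrite -EFinM; congr EFin.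
  rewrite !normal_pdfE ?oner_eq0// mulrCA [RHS]mulrCA /normal_fun -!expRD.
  by congr (_ * expR _); field.
rewrite ge0_integralZl//.
- by rewrite integral_normal_pdf mule1.
- by apply/measurable_EFinP; exact: measurable_normal_pdf.
- by move=> x _; rewrite lee_fin normal_pdf_ge0.
Qed.
End gauss.

(** * Exponential bounds for expectations of tests *)

Section chernoff.
Context (R : realType) (N M : nat) (d : measure_display) (T : measurableType d).
Context (P : probability T R) (xi : 'I_N -> 'I_M -> {RV P >-> R}).
Hypothesis hxi : iid_std_gaussian xi.
Implicit Types (S : 'M[R]_(N, M)) (w : 'I_N * 'I_M -> R).

Lemma integral_expR_noise w :
  (\int[P]_t (expR (\sum_c w c * xi c.1 c.2 t))%:E =
   (expR ((\sum_c w c ^+ 2) / 2))%:E)%E.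
Proof.
have [hd hi] := hxi.
under eq_integral do rewrite expR_sum.
rewrite mulr_suml expR_sum.
apply: (@expectation_prod_indep _ _ _ _ _ (fun c => xi c.1 c.2) _
    (fun c x => expR (w c * x))) => [B mB|c|c x|c].
- have := hi [set: _]%SET B mB.
  rewrite (_ : [set` [set: _]%SET] = setT); last first.
    by apply/seteqP; split => // c _; rewrite /= inE.
  by move=> ->; apply: eq_bigl => c; rewrite inE.
- by apply: measurableT_comp => //; exact: measurable_funM.
- exact: expR_ge0.
- rewrite -(integral_normal_expR _ (distribution P (xi c.1 c.2)) (w c) (hd c.1 c.2)).
  rewrite -(ge0_integral_distribution (xi c.1 c.2)
    (f := fun x => (expR (w c * x))%:E))//=.
  by apply/measurable_EFinP; apply: measurableT_comp => //; exact: measurable_funM.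
Qed.

(** As [Y] is [S] plus noise, each exponential splits into a constant depending on [S] and a noise
    factor of known mean. Summing over a family builds the union bound in. *)
Lemma expect_le_sum_expR S (psi : 'M[R]_(N, M) -> R) (I : Type) (r : seq I)
    (w : I -> 'I_N * 'I_M -> R) (b : I -> R) :
  (forall Y, 0 <= psi Y) ->
  (forall Y, psi Y <=
     \sum_(k <- r) expR (\sum_c w k c * Y c.1 c.2 + b k)) ->
  (expect xi S psi <= (\sum_(k <- r)
     expR (\sum_c w k c * S c.1 c.2 + (\sum_c w k c ^+ 2) / 2 + b k))%:E)%E.
Proof.
move=> psi0 psile; rewrite /expect unlock.
have mw (k : I) : measurable_fun setT (fun t => expR (\sum_c w k c * xi c.1 c.2 t)).
  apply: measurableT_comp => //; apply: measurable_sum => c.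
  exact: measurable_funM.
apply: (@le_trans _ _ (\int[P]_t (\sum_(k <- r)
   (expR (\sum_c w k c * S c.1 c.2 + b k))%:E *
     (expR (\sum_c w k c * xi c.1 c.2 t))%:E)))%E.
  apply: ge0_le_integral_nonmeasurable => t; rewrite ?lee_fin//.
  under eq_bigr do rewrite -EFinM -expRD.
  rewrite sumEFin lee_fin; apply: (le_trans (psile _)).
  rewrite le_eqVlt; apply/orP; left; apply/eqP; apply: eq_bigr => k _.
  congr expR; rewrite addrAC; congr (_ + _); rewrite -big_split/=.
  by apply: eq_bigr => c _; rewrite !mxE mulrDr.
rewrite ge0_integral_sum//; last first.
  by move=> k; apply: measurable_funeM; exact/measurable_EFinP.
rewrite -sumEFin; apply: lee_sum => k _.
rewrite ge0_integralZl//.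
- by rewrite integral_expR_noise -EFinM -expRD addrAC.
- exact/measurable_EFinP.
Qed.

(** Where the linear form is at most [h], [expR (l * (h - form))] is at least 1. A mean of at least
    [h + l] and a variance of at most 1 then give the exponent [- l ^+ 2 + l ^+ 2 / 2]. *)
Lemma expect_type2_le S (psi : 'M[R]_(N, M) -> R) (u : 'I_N * 'I_M -> R) (h l : R) :
  (forall Y, 0 <= psi Y <= 1) ->
  (forall Y : 'M[R]_(N, M), h < \sum_c u c * Y c.1 c.2 -> psi Y = 1) ->
  \sum_c u c ^+ 2 <= 1 -> 0 <= l -> h + l <= \sum_c u c * S c.1 c.2 ->
  (expect xi S (fun Y => (1 - psi Y)%R) <= (expR (- (l ^+ 2 / 2)))%:E)%E.
Proof.
move=> psi01 psi1 u1 l0 hl.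
apply: le_trans (@expect_le_sum_expR S _ unit [:: tt]
  (fun _ c => - l * u c) (fun _ => l * h) _ _) _.
- by move=> Y; rewrite subr_ge0; case/andP: (psi01 Y).
- move=> Y; rewrite big_seq1.
  under eq_bigr do rewrite -mulrA; rewrite -mulr_sumr.
  have [/psi1 ->|Yh] := ltP h (\sum_c u c * Y c.1 c.2); first by rewrite subrr expR_ge0.
  apply: (@le_trans _ _ 1); first by rewrite lerBlDr lerDl; case/andP: (psi01 Y).
  by rewrite -expR0 ler_expR mulNr addrC subr_ge0 ler_wpM2l.
- rewrite big_seq1 lee_fin ler_expR.
  under eq_bigr do rewrite -mulrA; rewrite -mulr_sumr.
  under [X in _ + X / 2 + _]eq_bigr do rewrite exprMn; rewrite -mulr_sumr.
  set m := \sum_c _ in hl *; set v := \sum_c _ in u1 *.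
  have l2 : 0 <= l ^+ 2 by exact: sqr_ge0.
  have : l ^+ 2 * v <= l ^+ 2 by rewrite ler_piMr.
  have : l * (h + l) <= l * m by rewrite ler_wpM2l.
  by rewrite sqrrN mulrDr -expr2; lra.
Qed.
End chernoff.

(** * Counting submatrices *)

Section combinatorics.
Local Open Scope nat_scope.

Lemma ffact_le_expn N n : N ^_ n <= N ^ n.
Proof.
elim: n => [|n IH]; first by rewrite ffactn0.
by rewrite ffactnSr expnSr leq_mul// leq_subr.
Qed.

Lemma card_rects_le N M n m : #|rects N M n m| <= 'C(N, n) * 'C(M, m).
Proof.
rewrite /rects curry_imset2X (leq_trans (leq_imset_card _ _))//.
by rewrite cardsX !card_draws !card_ord.
Qed.

Lemma card_in_rects N M n m C : C \in rects N M n m -> #|C| = n * m.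
Proof. by case/imset2P => A B + + ->; rewrite !inE cardsX => /eqP -> /eqP ->. Qed.

Lemma rects_neq0 N M n m : n <= N -> m <= M -> exists C, C \in rects N M n m.
Proof.
move=> nN mM.
have /card_gt0P[A]: 0 < #|[set A : {set 'I_N} | #|A| == n]%SET|.
  by rewrite card_draws card_ord bin_gt0.
have /card_gt0P[B]: 0 < #|[set B : {set 'I_M} | #|B| == m]%SET|.
  by rewrite card_draws card_ord bin_gt0.
by move=> hB hA; exists (finset.setX A B); apply/imset2P; exists A B.
Qed.

Lemma card_rects_gt0 N M n m : n <= N -> m <= M -> 0 < #|rects N M n m|.
Proof. by move=> nN mM; apply/card_gt0P; exact: rects_neq0. Qed.

End combinatorics.

(** The right side is [(e N / n) ^ n]. The binomial is at most [N ^ n / n!], and [n ^ n / n!] is a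
    single term of the series of [e ^ n]. *)
Lemma bin_le_expR (R : realType) N n : (0 < n <= N)%N ->
  ('C(N, n)%:R : R) <= expR (n%:R * (ln (N%:R / n%:R) + 1)).
Proof.
case/andP => n0 nN; have N0 := leq_trans n0 nN.
have fn : 0 < n`!%:R :> R by rewrite ltr0n fact_gt0.
apply: (@le_trans _ _ (N%:R ^+ n / n`!%:R)).
  by rewrite ler_pdivlMr// -natrM -natrX ler_nat bin_ffact ffact_le_expn.
rewrite mulrDr mulr1 expRD expRM_natl lnK ?posrE ?divr_gt0 ?ltr0n//.
rewrite expr_div_n -mulrA ler_wpM2l ?exprn_ge0//.
rewrite mulrC ler_pdivlMr ?exprn_gt0 ?ltr0n// mulrC.
case: n n0 nN fn => // n _ _ _.
by have := expR_ge1Dxn n (ler0n R n.+1); lra.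
Qed.

Lemma ln_card_rects_le (R : realType) N M n m :
  (0 < n <= N)%N -> (0 < m <= M)%N ->
  ln (#|rects N M n m|%:R : R) <=
  n%:R * (ln (N%:R / n%:R) + 1) + m%:R * (ln (M%:R / m%:R) + 1).
Proof.
move=> hn hm; have [n0 nN] := andP hn; have [m0 mM] := andP hm.
rewrite -[leRHS]expRK ler_ln ?posrE ?expR_gt0 ?ltr0n ?card_rects_gt0//.
rewrite expRD.
apply: le_trans (ler_pM _ _ (bin_le_expR R _ _ hn) (bin_le_expR R _ _ hm)) => //.
by rewrite -natrM ler_nat card_rects_le.
Qed.

(** If the last integer is counted, the count is at most that integer, hence at most [x]; otherwise
    the count does not change. *)
Lemma count_nat_le (R : realType) (N : nat) (x : R) : 0 <= x ->
  \sum_(1 <= n < N.+1 | n%:R <= x) 1 <= x.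
Proof.
move=> x0; elim: N => [|N IH]; first by rewrite big_geq.
rewrite big_mkcond big_nat_recr//= -big_mkcond/=.
case: ifP => [Nx|_]; last by rewrite addr0.
apply: le_trans Nx; rewrite -[leRHS]natr1 lerD2r big_mkcond/=.
apply: (@le_trans _ _ (\sum_(1 <= n < N.+1) 1)).
  by apply: ler_sum => i _; case: ifP.
by rewrite sumr_const_nat subn1.
Qed.

(** * The critical value [V] *)

Lemma V_ge0 (R : realType) N M n m : 0 <= V N M R n m.
Proof. exact: sqrtr_ge0. Qed.

Lemma V_sqr (R : realType) N M n m : (0 < n <= N)%N -> (0 < m <= M)%N ->
  V N M R n m ^+ 2 = 2 * (ln N%:R + ln M%:R + ln #|rects N M n m|%:R).
Proof.
move=> /andP[n0 nN] /andP[m0 mM].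
have N0 := leq_trans n0 nN; have M0 := leq_trans m0 mM.
have G0 := card_rects_gt0 N M n m nN mM.
(* Squaring undoes [Num.sqrt] only on nonnegative arguments; here the logarithm is that of a product
   of positive integers. *)
rewrite /V sqr_sqrtr.
  by rewrite !lnM ?posrE ?mulr_gt0 ?ltr0n.
by rewrite mulr_ge0 ?ln_ge0// -!natrM ler1n !muln_gt0 N0 M0.
Qed.

(** This is the total cost, in the union bound under the null, of all rectangles of one size. *)
Lemma expR_V (R : realType) N M n m : (0 < n <= N)%N -> (0 < m <= M)%N ->
  #|rects N M n m|%:R * expR (- (V N M R n m ^+ 2 / 2)) = (N%:R * M%:R)^-1.
Proof.
move=> /[dup] hn /andP[n0 nN] /[dup] hm /andP[m0 mM].
have N0 := leq_trans n0 nN; have M0 := leq_trans m0 mM.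
have G0 := card_rects_gt0 N M n m nN mM.
rewrite V_sqr// mulrAC divff// mul1r expRN !expRD !lnK ?posrE ?ltr0n//.
by rewrite invfM mulrC mulfVK// gt_eqF// ltr0n.
Qed.

(** * The tests as linear forms, and the error under the null *)

Section tests.
Context (R : realType) (N M : nat).
Implicit Types (K : set (nat * nat)) (H : R) (Y : 'M[R]_(N, M)).

Lemma psi_star01 K H Y : 0 <= psi_star K H Y <= 1.
Proof.
rewrite /psi_star /psi_lin /psi_max le_max ge_max.
by case: (H < _)%R; case: (1 < _)%E; rewrite /= ?lexx ?ler01.
Qed.

Lemma psi_star_lin K H Y : H < t_lin Y -> psi_star K H Y = 1.
Proof.
move=> HY; have /andP[_ le1] := psi_star01 K H Y.
apply/le_anti; rewrite le1/= /psi_star /psi_lin HY.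
by rewrite le_max lexx.
Qed.

Lemma t_max_gt1 K Y : (1 < t_max K Y)%E <->
  exists n m C, [/\ K (n, m), C \in rects N M n m & 1 < Ysum n m C Y / V N M R n m].
Proof.
rewrite /t_max /supK; split.
  (* The initial value [-oo] of the maximum cannot exceed 1, so some rectangle does. *)
  move/ereal_sup_gt => [_ [[n m] Knm <-]] /bigmax_gtP[|[C CC]].
    by rewrite ltNge leNye.
  by rewrite lte_fin => h; exists n, m, C.
move=> [n [m [C [Knm CC h]]]].
apply: (@lt_le_trans _ _ (\big[maxe/-oo%E]_(C in rects N M n m)
   (Ysum n m C Y / V N M R n m)%:E)).
  by apply/bigmax_gtP; right; exists C; rewrite ?lte_fin.
by apply: ereal_sup_ubound; exists (n, m).
Qed.

Lemma psi_star_max K H Y n m C : K (n, m) -> C \in rects N M n m ->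
  0 < V N M R n m -> V N M R n m < Ysum n m C Y -> psi_star K H Y = 1.
Proof.
move=> Knm CC V0 VY; have /andP[_ le1] := psi_star01 K H Y.
apply/le_anti; rewrite le1/= /psi_star /psi_max.
have -> : (1 < t_max K Y)%E.
  by apply/t_max_gt1; exists n, m, C; rewrite ltr_pdivlMr// mul1r.
by rewrite le_max lexx orbT.
Qed.

(** Like [w_rect] below, a coefficient vector of Euclidean norm 1 that puts a test statistic in the
    form required by the exponential bounds. *)
Definition w_lin (c : 'I_N * 'I_M) : R := (Num.sqrt (N%:R * M%:R))^-1.

Definition w_rect (n m : nat) (C : {set 'I_N * 'I_M}) (c : 'I_N * 'I_M) : R :=
  if c \in C then (Num.sqrt (n%:R * m%:R))^-1 else 0.

Lemma t_linE Y : t_lin Y = \sum_c w_lin c * Y c.1 c.2.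
Proof.
rewrite /t_lin pair_bigA/= mulr_suml; apply: eq_bigr => c _.
by rewrite mulrC.
Qed.

Lemma YsumE n m C Y : Ysum n m C Y = \sum_c w_rect n m C c * Y c.1 c.2.
Proof.
rewrite /Ysum mulr_suml big_mkcond/=; apply: eq_bigr => c _.
by rewrite /w_rect; case: ifP; rewrite ?mul0r// mulrC.
Qed.

Lemma sqr_w_lin : (0 < N)%N -> (0 < M)%N -> \sum_c w_lin c ^+ 2 = 1.
Proof.
move=> N0 M0; rewrite /w_lin sumr_const card_prod !card_ord exprVn.
rewrite sqr_sqrtr ?mulr_ge0// -[LHS]mulr_natr natrM mulVf//.
by rewrite mulf_neq0// pnatr_eq0 -lt0n.
Qed.

Lemma sqr_w_rect n m C : (0 < n)%N -> (0 < m)%N -> C \in rects N M n m ->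
  \sum_c w_rect n m C c ^+ 2 = 1.
Proof.
move=> n0 m0 CC; transitivity (\sum_(c in C) (n%:R * m%:R)^-1 : R).
  rewrite [RHS]big_mkcond/=; apply: eq_bigr => c _; rewrite /w_rect.
  by case: ifP; rewrite ?expr0n// exprVn sqr_sqrtr// mulr_ge0.
rewrite sumr_const (card_in_rects _ _ _ _ _ CC) -[LHS]mulr_natr natrM mulVf//.
by rewrite mulf_neq0// pnatr_eq0 -lt0n.
Qed.

(** For [h >= 0] the indicator of [Z > h] is at most [expR (h * Z - h ^+ 2)]; the slope [h]
    minimises the null expectation, [expR (- (h ^+ 2 / 2))]. The list [r] makes the union bound over
    [K] a finite sum. *)
Lemma psi_star_le K H Y (r : seq (nat * nat)) : 0 <= H ->
  (forall n m, K (n, m) -> (n, m) \in r) ->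
  psi_star K H Y <= expR (H * t_lin Y - H ^+ 2) +
    \sum_(nm <- r) \sum_(C in rects N M nm.1 nm.2)
       expR (V N M R nm.1 nm.2 * Ysum nm.1 nm.2 C Y - V N M R nm.1 nm.2 ^+ 2).
Proof.
move=> H0 Kr; set S := \sum_(nm <- r) _.
have S0 : 0 <= S by apply: sumr_ge0 => nm _; apply: sumr_ge0 => C _; exact: expR_ge0.
have e0 : 0 <= expR (H * t_lin Y - H ^+ 2) by exact: expR_ge0.
rewrite /psi_star /psi_lin ge_max; apply/andP; split.
  have [HY|_] := ltP H (t_lin Y); last exact: addr_ge0.
  apply: ler_wpDr => //=; rewrite -expR0 ler_expR subr_ge0 expr2.
  by rewrite ler_wpM2l// ltW.
rewrite /psi_max; have [|_] := boolP (1 < t_max K Y)%E; last exact: addr_ge0.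
move/t_max_gt1 => [n [m [C [/Kr nmr CC h]]]].
apply: ler_wpDl => //.
apply: (@le_trans _ _ (expR (V N M R n m * Ysum n m C Y - V N M R n m ^+ 2))).
  (* If [V] were 0, the quotient would be 0 by the convention on division and could not exceed 1. *)
  have V0 : 0 < V N M R n m.
    rewrite lt_neqAle V_ge0 andbT eq_sym; apply/eqP => V0.
    by move: h; rewrite V0 invr0 mulr0 ltNge ler01.
  move: h; rewrite ltr_pdivlMr// mul1r => h.
  by rewrite -expR0 ler_expR subr_ge0 expr2 ler_wpM2l// ltW.
rewrite /S (big_rem _ nmr)/=; apply: ler_wpDr.
  by apply: sumr_ge0 => nm _; apply: sumr_ge0 => D _; exact: expR_ge0.
rewrite (bigD1 C)//=; apply: ler_wpDr => //.
by apply: sumr_ge0 => D _; exact: expR_ge0.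
Qed.

Context (d : measure_display) (T : measurableType d).
Context (P : probability T R) (xi : 'I_N -> 'I_M -> {RV P >-> R}).
Hypothesis hxi : iid_std_gaussian xi.

(** At most [e * N] values of [n] and [M] values of [m] occur in [K]. Each size costs [1 / (N M)],
    so the maximum test contributes at most [e]. *)
Lemma expect_psi_star0_le K H e : (0 < N)%N -> (0 < M)%N ->
  (forall n m, K (n, m) -> (1 <= n <= N)%N /\ (1 <= m <= M)%N) ->
  0 <= H -> 0 <= e -> (forall n m, K (n, m) -> relsize R n N <= e) ->
  (expect xi 0 (psi_star K H) <= (expR (- (H ^+ 2 / 2)) + e)%:E)%E.
Proof.
move=> N0 M0 Ksub H0 e0 Ke.
(* The finite grid of all sizes, filtered by [K]. *)
pose r := [seq nm <- [seq (n, m) | n <- index_iota 1 N.+1, m <- index_iota 1 M.+1]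
  | nm \in K].
have Kr n m : K (n, m) -> (n, m) \in r.
  move=> Knm; have [hn hm] := Ksub _ _ Knm.
  rewrite mem_filter mem_set//=; apply/allpairsP; exists (n, m) => /=.
  by rewrite !mem_index_iota !ltnS.
have rK nm : nm \in r ->
    [/\ (0 < nm.1 <= N)%N, (0 < nm.2 <= M)%N & nm.1%:R <= e * N%:R].
  case: nm => n m; rewrite mem_filter => /andP[/set_mem Knm _].
  have [hn hm] := Ksub _ _ Knm.
  by split => //=; rewrite -ler_pdivrMr ?ltr0n//; exact: Ke Knm.
have sizer : (size r)%:R <= e * (N%:R * M%:R).
  rewrite mulrA -sum1_size natr_sum big_filter.
  apply: (@le_trans _ _ (\sum_(nm <- [seq (n, m) | n <- index_iota 1 N.+1,
     m <- index_iota 1 M.+1] | nm.1%:R <= e * N%:R) 1)).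
    rewrite [leLHS]big_mkcond [leRHS]big_mkcond/=.
    rewrite !big_seq; apply: ler_sum => nm nmA.
    case: ifPn => [nmK|_]; last by case: ifP.
    by have [|_ _ ->] := rK nm; rewrite ?mem_filter ?nmK.
  rewrite big_mkcond big_allpairs_dep/=.
  rewrite [leLHS](_ : _ = M%:R * \sum_(1 <= n < N.+1 | n%:R <= e * N%:R) 1).
    by rewrite mulrC ler_wpM2r// count_nat_le// mulr_ge0.
  rewrite [in RHS]big_mkcond/= mulr_sumr; apply: eq_bigr => n _.
  by rewrite sumr_const_nat subn1 mulr_natl.
(* [None] stands for the linear test and [Some] for a size with a rectangle, so one application of
   the exponential bound covers both tests. *)
pose I := option ((nat * nat) * {set 'I_N * 'I_M}).
pose s : seq I := None ::
  [seq Some (nm, C) | nm <- r, C <- enum (rects N M nm.1 nm.2)].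
pose w (k : I) : 'I_N * 'I_M -> R := match k with
  | None => fun c => H * w_lin c
  | Some (nm, C) => fun c => V N M R nm.1 nm.2 * w_rect nm.1 nm.2 C c end.
pose b (k : I) : R := match k with
  | None => - H ^+ 2
  | Some (nm, C) => - V N M R nm.1 nm.2 ^+ 2 end.
apply: le_trans (expect_le_sum_expR _ _ _ _ _ _ _ hxi 0 _ I s w b _ _) _.
- by move=> Y; case/andP: (psi_star01 K H Y).
- move=> Y; apply: le_trans (psi_star_le K H Y r H0 Kr) _.
  rewrite big_cons big_allpairs_dep/= le_eqVlt; apply/orP; left; apply/eqP.
  congr (_ + _).
    rewrite t_linE mulr_sumr; congr (expR (_ + _)).
    by apply: eq_bigr => c _; rewrite mulrA.
  apply: eq_bigr => nm _; rewrite big_enum/=; apply: eq_bigr => C _.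
  rewrite YsumE mulr_sumr; congr (expR (_ + _)).
  by apply: eq_bigr => c _; rewrite mulrA.
rewrite lee_fin big_cons big_allpairs_dep/=; apply: lerD.
  (* The mean term vanishes under the null, leaving the exponent [H ^+ 2 / 2 - H ^+ 2]. *)
  rewrite big1 ?add0r => [|c _]; last by rewrite mxE mulr0.
  under eq_bigr do rewrite exprMn.
  by rewrite -mulr_sumr sqr_w_lin// ler_expR mulr1; lra.
apply: (@le_trans _ _ (\sum_(nm <- r) (N%:R * M%:R)^-1)); last first.
  rewrite big_const_seq count_predT iter_addr addr0 -[leLHS]mulr_natl ler_pdivrMr//.
  by rewrite mulr_gt0 ?ltr0n.
rewrite !big_seq; apply: ler_sum => nm /rK[hn hm _].
rewrite -(expR_V _ _ _ _ _ hn hm) big_enum/=.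
rewrite mulr_natl -sumr_const; apply: ler_sum => C CC.
have [/andP[n0 _] /andP[m0 _]] := (hn, hm).
rewrite big1 ?add0r => [|c _]; last by rewrite mxE mulr0.
under eq_bigr do rewrite exprMn.
by rewrite -mulr_sumr sqr_w_rect// ler_expR mulr1; lra.
Qed.
End tests.

(** * The error under the alternatives *)

Section type2.
Context (R : realType) (N M : nat) (d : measure_display) (T : measurableType d).
Context (P : probability T R) (xi : 'I_N -> 'I_M -> {RV P >-> R}).
Hypothesis hxi : iid_std_gaussian xi.
Context (n m : nat) (C : {set 'I_N * 'I_M}) (a : R) (S : 'M[R]_(N, M)).
Hypotheses (n0 : (0 < n)%N) (m0 : (0 < m)%N) (CC : C \in rects N M n m).
Hypothesis SC : forall i j, ((i, j) \notin C -> S i j = 0) /\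
                            ((i, j) \in C -> a <= S i j).
Implicit Types (K : set (nat * nat)) (H l : R).

Lemma sum_signal_ge : a * (n%:R * m%:R) <= \sum_(c in C) S c.1 c.2.
Proof.
rewrite -natrM -(card_in_rects _ _ _ _ _ CC) mulr_natr -sumr_const.
by apply: ler_sum => -[i j] Cij; exact: (SC i j).2.
Qed.

(** Entries outside [C] vanish, so [t_lin] has mean at least [a n m / sqrt (N M)], which equals
    [a sqrt (n m p q)]; [l] is the excess over [H]. *)
Lemma expect_lin_le K H l : (0 < N)%N -> (0 < M)%N -> 0 <= l ->
  H + l <= a * Num.sqrt (n%:R * m%:R * relsize R n N * relsize R m M) ->
  (expect xi S (fun Y => (1 - psi_star K H Y)%R) <= (expR (- (l ^+ 2 / 2)))%:E)%E.
Proof.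
move=> N0 M0 l0 hl.
apply: (expect_type2_le _ _ _ _ _ _ _ hxi S (psi_star K H) (@w_lin R N M) H) => //.
- exact: psi_star01.
- by move=> Y; rewrite -t_linE; exact: psi_star_lin.
- by rewrite sqr_w_lin.
apply: (le_trans hl).
have -> : \sum_c w_lin R N M c * S c.1 c.2 =
    (\sum_(c in C) S c.1 c.2) / Num.sqrt (N%:R * M%:R).
  rewrite -mulr_sumr mulrC; congr (_ / _); rewrite [RHS]big_mkcond/=.
  by apply: eq_bigr => -[i j] _; case: ifPn => // Cij; rewrite (SC i j).1.
have -> : Num.sqrt (n%:R * m%:R * relsize R n N * relsize R m M) =
    n%:R * m%:R / Num.sqrt (N%:R * M%:R).
  have -> : n%:R * m%:R * relsize R n N * relsize R m M =
      (n%:R * m%:R) ^+ 2 / (N%:R * M%:R) by rewrite /relsize invfM; ring.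
  rewrite (sqrtrM (_^-1)) ?sqr_ge0// sqrtr_sqr sqrtrV ?mulr_ge0//.
  by rewrite ger0_norm// mulr_ge0.
by rewrite mulrA ler_wpM2r ?invr_ge0//; exact: sum_signal_ge.
Qed.

(** Among all scanned rectangles the support [C] of the signal is enough: the test rejects as soon
    as its statistic exceeds [V]. *)
Lemma expect_max_le K H l : K (n, m) -> 0 < V N M R n m -> 0 <= l ->
  V N M R n m + l <= a * Num.sqrt (n%:R * m%:R) ->
  (expect xi S (fun Y => (1 - psi_star K H Y)%R) <= (expR (- (l ^+ 2 / 2)))%:E)%E.
Proof.
move=> Knm V0 l0 hl.
apply: (expect_type2_le _ _ _ _ _ _ _ hxi S (psi_star K H) (w_rect R N M n m C)
  (V N M R n m)) => //.
- exact: psi_star01.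
- by move=> Y; rewrite -YsumE; exact: psi_star_max.
- by rewrite sqr_w_rect.
apply: (le_trans hl); rewrite -YsumE /Ysum ler_pdivlMr; last first.
  by rewrite sqrtr_gt0 mulr_gt0// ltr0n.
by rewrite -mulrA -expr2 sqr_sqrtr ?mulr_ge0//; exact: sum_signal_ge.
Qed.
End type2.

(** With [D = n ln (N / n) + m ln (M / m)], the hypotheses give [V ^+ 2 <= 2 (1 + 2 e) D], while the
    squared signal is at least [2 (1 + dl) D]. The margin [e * V] fits because
    [(1 + e) ^+ 2 * (1 + 2 * e) <= 1 + 8 * e]. *)
Lemma V_le_signal (R : realType) N M n m (a e dl : R) :
  (0 < n < N)%N -> (0 < m < M)%N -> 0 < a -> 0 < e <= 8^-1 -> 8 * e <= dl ->
  1 <= e * ln (N%:R / n%:R) -> 1 <= e * ln (M%:R / m%:R) ->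
  ln N%:R <= e * (n%:R * ln (N%:R / n%:R)) ->
  ln M%:R <= e * (m%:R * ln (M%:R / m%:R)) ->
  1 + dl <= a ^+ 2 * n%:R * m%:R /
    (2 * (n%:R * ln (N%:R / n%:R) + m%:R * ln (M%:R / m%:R))) ->
  V N M R n m + e * V N M R n m <= a * Num.sqrt (n%:R * m%:R).
Proof.
move=> /andP[n0 nN] /andP[m0 mM] a0 /andP[e0 e8] ed.
set x := ln (_ / _) => hx; set y := ln (_ / _) => hy hN hM had.
have n0' : 0 < n%:R :> R by rewrite ltr0n.
have m0' : 0 < m%:R :> R by rewrite ltr0n.
have x0 : 0 < x by rewrite -(pmulr_rgt0 _ e0); lra.
have y0 : 0 < y by rewrite -(pmulr_rgt0 _ e0); lra.
set D := n%:R * x + m%:R * y in had *.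
have D0 : 0 < D by rewrite addr_gt0 ?mulr_gt0.
(* One [e * D] absorbs [ln N + ln M], the other absorbs the terms [n + m] of the binomial bounds. *)
have hV : V N M R n m ^+ 2 <= 2 * ((1 + 2 * e) * D).
  have hn : (0 < n <= N)%N by rewrite n0 ltnW.
  have hm : (0 < m <= M)%N by rewrite m0 ltnW.
  rewrite V_sqr// ler_pM2l// mulrDl mul1r -mulrA.
  have := ln_card_rects_le R N M n m hn hm; rewrite -/x -/y !mulrDr !mulr1.
  have : n%:R * 1 <= e * (n%:R * x) by rewrite mulrCA ler_pM2l.
  have : m%:R * 1 <= e * (m%:R * y) by rewrite mulrCA ler_pM2l.
  rewrite /D !mulr1; move: hN hM.
  move: (n%:R * x) (m%:R * y) => p q; move: (e * p) (e * q) => u v.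
  clear; lra.
have {}had : (1 + dl) * (2 * D) <= a ^+ 2 * n%:R * m%:R.
  by rewrite -ler_pdivlMr// mulr_gt0.
rewrite -{1}(mul1r (V _ _ _ _ _)) -mulrDl -ler_sqr ?nnegrE; first last.
- by rewrite mulr_ge0 ?sqrtr_ge0// ltW.
- by rewrite mulr_ge0 ?sqrtr_ge0// addr_ge0// ltW.
have nm0 : 0 <= n%:R * m%:R :> R by rewrite mulr_ge0.
rewrite !exprMn (sqr_sqrtr nm0) [leRHS]mulrA.
apply: le_trans _ had.
apply: (@le_trans _ _ ((1 + e) ^+ 2 * (2 * ((1 + 2 * e) * D)))).
  by rewrite ler_wpM2l ?sqr_ge0.
have -> : (1 + e) ^+ 2 * (2 * ((1 + 2 * e) * D)) =
  ((1 + e) ^+ 2 * (1 + 2 * e)) * (2 * D) by ring.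
rewrite ler_wpM2r ?mulr_ge0 ?ltW//.
(* Since [e <= 1/8], both [e ^+ 2] and [e ^+ 3] are at most [e / 8], and [4 + 5/8 + 2/8] is below
   8. *)
have : e * e <= e * 8^-1 by rewrite ler_wpM2l// ltW.
have : e * e * e <= e * 8^-1 * 1.
  by rewrite ler_pM ?mulr_ge0// ?ler_wpM2l// ?ltW//; lra.
have -> : (1 + e) ^+ 2 * (1 + 2 * e) =
  1 + 4 * e + 5 * (e * e) + 2 * (e * e * e) by ring.
lra.
Qed.

(** * From limits to bounds uniform over the sizes *)

Lemma expR_gauss_small (R : realType) (e : R) : 0 < e ->
  exists2 A : R, 0 < A & forall x, A <= x -> expR (- (x ^+ 2 / 2)) <= e.
Proof.
(* The summand 1 ensures [x >= 1], hence [x ^+ 2 / 2 >= x / 2 >= - ln e]. *)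
move=> e0; exists (1 + 2 * `|ln e|) => [|x Ax]; first by rewrite ltr_wpDr// mulr_ge0.
rewrite -[leRHS]lnK ?posrE// ler_expR.
have h0 := normr_ge0 (ln e); have h1 := ler_norm (- ln e); rewrite normrN in h1.
have : x * 1 <= x * x by rewrite ler_wpM2l; lra.
rewrite expr2; lra.
Qed.

Lemma cvge0_near_le (R : realType) (T : Type) (F : set_system T) {FF : Filter F}
    (f : T -> \bar R) :
  (forall e : R, 0 < e -> \forall x \near F, (0 <= f x <= e%:E)%E) ->
  f @ F --> 0%E.
Proof.
(* The bound at level 1 already gives finiteness, which reduces the claim to real convergence. *)
move=> fe; have ffin : \forall x \near F, f x \is a fin_num.
  apply: filterS (fe 1 ltr01) => x /andP[f0 f1].
  by rewrite ge0_fin_numE// (le_lt_trans f1)// ltry.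
apply/fine_cvgP; split => //; apply/cvgrPdist_le => e e0.
apply: filterS2 ffin (fe e e0) => x xfin /andP[f0 f1].
by rewrite sub0r normrN ger0_norm ?fine_ge0// -lee_fin fineK.
Qed.

Lemma supK_cvg0_near (R : realType) (F : set_system (nat * nat)) {FF : Filter F}
    (K : nat -> nat -> set (nat * nat)) (f : nat * nat -> nat -> nat -> R) :
  supK (K NM.1 NM.2) (fun n m => (f NM n m)%:E) @[NM --> F] --> 0%E ->
  forall e, 0 < e -> \forall NM \near F,
    forall n m, K NM.1 NM.2 (n, m) -> f NM n m < e.
Proof.
move=> fK e e0.
have : \forall NM \near F, (supK (K NM.1 NM.2) (fun n m => (f NM n m)%:E) < e%:E)%E.
  apply: (fK [set u | u < e%:E]%E).
  by apply: open_ereal_lt'; rewrite lte_fin.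
apply: filterS => NM h n m Knm; rewrite -lte_fin; apply: le_lt_trans h.
by apply: ereal_sup_ubound; exists (n, m).
Qed.

Lemma infK_le (R : realType) (K : set (nat * nat)) (f : nat -> nat -> \bar R) n m :
  K (n, m) -> (infK K f <= f n m)%E.
Proof. by move=> Knm; apply: ereal_inf_lbound; exists (n, m). Qed.

(** The lower limit is minus an infimum, over sets of [F], of suprema of negated values. Being
    strictly above 1, it provides one set of [F] whose supremum is below -1, and this fixes the gap
    [dl]. *)
Lemma cond_ii_near (R : realType) (F : set_system (nat * nat)) {FF : Filter F}
    (K : nat -> nat -> set (nat * nat)) (a : nat -> nat -> nat -> nat -> R) :
  cond_ii F K a -> exists2 dl : R, 0 < dl & \forall NM \near F,
    forall n m, K NM.1 NM.2 (n, m) ->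
    1 + dl <= a NM.1 NM.2 n m ^+ 2 * n%:R * m%:R /
      (2 * (n%:R * ln (NM.1%:R / n%:R) + m%:R * ln (NM.2%:R / m%:R))).
Proof.
rewrite /cond_ii /limf_einf /limf_esup; set f := (X in ereal_inf X).
rewrite lteNr => /ereal_inf_lt[_ [A FA <-]] hA.
have [dl dl0 dlA] : exists2 dl : R, 0 < dl & (ereal_sup [set (- infK (K NM.1 NM.2)
   (fun n m => (a NM.1 NM.2 n m ^+ 2 * n%:R * m%:R /
       (2 * (n%:R * ln ((relsize R n NM.1)^-1) +
             m%:R * ln ((relsize R m NM.2)^-1))))%:E))%E | NM in A]
   <= - (1 + dl)%:E)%E.
  (* A finite supremum [r] leaves the gap [- 1 - r]; if it is [-oo], any gap works and 1 is
     taken. *)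
  move: hA; case: ereal_sup => [r|//|_]; last by exists 1; rewrite ?leNye.
  rewrite -EFinN lte_fin => hr; exists (- 1 - r); first by lra.
  by rewrite lee_fin; lra.
exists dl => //; apply: filterS FA => NM NMA n m Knm.
rewrite -lee_fin; move: dlA; rewrite leeNr => dlA.
apply: (le_trans dlA); rewrite -[leRHS]oppeK leeN2.
rewrite -(invf_div n%:R) -(invf_div m%:R).
apply: le_trans (ereal_sup_ubound _); last by exists NM; [exact: NMA|reflexivity].
rewrite leeN2; exact: (infK_le _ _ (fun n m => _) n m Knm).
Qed.

(** * Combination of the two errors along the filter *)

Theorem theorem2p3 (R : realType)
  (* any regime in which N -> oo and M -> oo *)
  (F : set_system (nat * nat)) (FF : ProperFilter F)
  (FN : NM.1 @[NM --> F] --> \oo) (FM : NM.2 @[NM --> F] --> \oo)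
  (* the noise *)
  (d : nat -> nat -> measure_display)
  (T : forall N M, measurableType (d N M))
  (P : forall N M, probability (T N M) R)
  (xi : forall N M, 'I_N -> 'I_M -> {RV (P N M) >-> R})
  (hxi : forall N M, iid_std_gaussian (xi N M))
  (* the sets of submatrix sizes *)
  (K : nat -> nat -> set (nat * nat))
  (K_sub : forall N M n m, K N M (n, m) ->
     (1 <= n <= N)%N /\ (1 <= m <= M)%N)
  (K_neq0 : forall N M, (0 < N)%N -> (0 < M)%N -> K N M !=set0)
  (K_size : supK (K NM.1 NM.2) (fun n m =>
     (n%:R^-1 + m%:R^-1 + relsize R n NM.1 + relsize R m NM.2)%:E)
     @[NM --> F] --> 0%E)
  (K_log : supK (K NM.1 NM.2) (fun n m =>
     (ln NM.1%:R / (n%:R * ln ((relsize R n NM.1)^-1)) +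
      ln NM.2%:R / (m%:R * ln ((relsize R m NM.2)^-1)))%:E)
     @[NM --> F] --> 0%E)
  (* the signal levels *)
  (a : nat -> nat -> nat -> nat -> R)
  (a_gt0 : forall N M n m, K N M (n, m) -> 0 < a N M n m)
  (ha : cond_i F K a \/ cond_ii F K a)
  (* the threshold of the linear test *)
  (H : nat -> nat -> R)
  (H_oo : H NM.1 NM.2 @[NM --> F] --> +oo)
  (H_le : cond_i F K a -> exists2 c : R, 0 < c < 1 &
     \forall NM \near F,
       ((H NM.1 NM.2)%:E <= c%:E * infK (K NM.1 NM.2) (fun n m =>
          (a NM.1 NM.2 n m *
           Num.sqrt (n%:R * m%:R * relsize R n NM.1 * relsize R m NM.2))%:E))%E) :
  risk (xi NM.1 NM.2) (alt (K NM.1 NM.2) (a NM.1 NM.2))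
    (psi_star (K NM.1 NM.2) (H NM.1 NM.2)) @[NM --> F] --> 0%E.
Proof.
have Npos : \forall NM \near F, (0 < NM.1)%N.
  by apply: (FN [set k | (0 < k)%N]); exists 1%N.
have Mpos : \forall NM \near F, (0 < NM.2)%N.
  by apply: (FM [set k | (0 < k)%N]); exists 1%N.
apply: cvge0_near_le => e e0.
(* One third each for the linear test under the null, the maximum test under the null, and the
   alternatives. *)
have e30 : 0 < e / 3 by rewrite divr_gt0.
have [A A0 hA] := expR_gauss_small R (e / 3) e30.
have Hge B : \forall NM \near F, B <= H NM.1 NM.2.
  by apply: (H_oo [set x | B <= x]); exact: nbhs_pinfty_ge (num_real B).
have hsize := supK_cvg0_near R F K
  (fun NM n m => n%:R^-1 + m%:R^-1 + relsize R n NM.1 + relsize R m NM.2) K_size.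
have type2 : \forall NM \near F, forall S,
    alt (K NM.1 NM.2) (a NM.1 NM.2) S ->
    (expect (xi NM.1 NM.2) S
      (fun Y => (1 - psi_star (K NM.1 NM.2) (H NM.1 NM.2) Y)%R) <= (e / 3)%:E)%E.
  case: ha => [hi|hii].
    have [c /andP[c0 c1] hH] := H_le hi.
    have k0 : 0 < c^-1 - 1 by rewrite subr_gt0 invf_gt1.
    near=> NM; move=> S [[n m] /= Knm [C CC SC]].
    have [/andP[n0 nN] /andP[m0 mM]] := K_sub _ _ _ _ Knm.
    have N0 : (0 < NM.1)%N by near: NM.
    have M0 : (0 < NM.2)%N by near: NM.
    (* This makes the excess [H * (c^-1 - 1)] of the mean over [H] at least [A]. *)
    have hb : A / (c^-1 - 1) <= H NM.1 NM.2 by near: NM; exact: Hge.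
    rewrite ler_pdivrMr// in hb.
    apply: le_trans (expect_lin_le _ _ _ _ _ _ _ (hxi _ _) n m C
      (a NM.1 NM.2 n m) S CC SC _ _ (H NM.1 NM.2 * (c^-1 - 1)) N0 M0 _ _) _.
    - by apply: le_trans hb; exact: ltW.
    - rewrite mulrBr mulr1 addrC subrK ler_pdivrMr// mulrC -lee_fin.
      have : ((H NM.1 NM.2)%:E <= c%:E * infK (K NM.1 NM.2) (fun n m =>
          (a NM.1 NM.2 n m *
           Num.sqrt (n%:R * m%:R * relsize R n NM.1 * relsize R m NM.2))%:E))%E.
        by near: NM.
      move/le_trans; apply; rewrite EFinM; apply: lee_wpmul2l.
        by rewrite lee_fin ltW.
      by apply: ereal_inf_lbound; exists (n, m).
    - by rewrite lee_fin; exact: hA.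
  have [dl dl0 hdl] := cond_ii_near _ _ _ _ hii.
  (* The minimum secures both [eps <= 1/8] and [8 * eps <= dl]. *)
  pose eps := Num.min dl 1 / 8.
  have eps0 : 0 < eps by rewrite divr_gt0// lt_min dl0 ltr01.
  have eps8 : eps <= 8^-1 by rewrite /eps ler_pdivrMr// mulVf// ge_min lexx orbT.
  have epsd : 8 * eps <= dl by rewrite /eps mulrC divfK// ge_min lexx.
  have logK := supK_cvg0_near R F K (fun NM n m =>
     ln NM.1%:R / (n%:R * ln ((relsize R n NM.1)^-1)) +
      ln NM.2%:R / (m%:R * ln ((relsize R m NM.2)^-1))) K_log _ eps0.
  (* The size condition is used at this level, since [p < expR (- eps^-1)] yields
     [1 <= eps * ln (p^-1)]. *)
  have s0 : 0 < expR (- eps^-1) :> R by exact: expR_gt0.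
  (* As [V ^+ 2 >= 2 * ln N], this forces [eps * V >= A], so the margin over [V] is large enough. *)
  have lnN : \forall NM \near F, (A / eps) ^+ 2 / 2 <= ln NM.1%:R :> R.
    have : \forall NM \near F, expR ((A / eps) ^+ 2 / 2) <= NM.1%:R :> R.
      by apply: (FN [set k | expR ((A / eps) ^+ 2 / 2) <= k%:R]); exact: nbhs_infty_ger.
    apply: filterS => NM h; rewrite -[leLHS]expRK ler_ln ?posrE ?expR_gt0//.
    exact: lt_le_trans (expR_gt0 _) h.
  near=> NM; move=> S [[n m] /= Knm [C CC SC]].
  have [/andP[n0 nN] /andP[m0 mM]] := K_sub _ _ _ _ Knm.
  have N0 : (0 < NM.1)%N by near: NM.
  have M0 : (0 < NM.2)%N by near: NM.
  have nR : 0 < n%:R :> R by rewrite ltr0n.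
  have mR : 0 < m%:R :> R by rewrite ltr0n.
  have NR : 0 < NM.1%:R :> R by rewrite ltr0n.
  have MR : 0 < NM.2%:R :> R by rewrite ltr0n.
  have p0 : 0 < relsize R n NM.1 by rewrite divr_gt0.
  have q0 : 0 < relsize R m NM.2 by rewrite divr_gt0.
  have hs : forall n m, K NM.1 NM.2 (n, m) ->
     n%:R^-1 + m%:R^-1 + relsize R n NM.1 + relsize R m NM.2 < expR (- eps^-1).
    by near: NM; exact: hsize.
  have hl : forall n m, K NM.1 NM.2 (n, m) ->
     ln NM.1%:R / (n%:R * ln ((relsize R n NM.1)^-1)) +
      ln NM.2%:R / (m%:R * ln ((relsize R m NM.2)^-1)) < eps.
    by near: NM; exact: logK.
  have {}hs := hs _ _ Knm; have {}hl := hl _ _ Knm.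
  have ni : 0 < n%:R^-1 :> R by rewrite invr_gt0.
  have mi : 0 < m%:R^-1 :> R by rewrite invr_gt0.
  have lnp x : 0 < x -> x < expR (- eps^-1) -> 1 <= eps * ln (x^-1).
    move=> x0 hx; rewrite lnV ?posrE// -ler_pdivrMl// mulr1 -[leLHS]opprK lerN2.
    by rewrite -[leRHS]expRK ler_ln ?posrE// ltW.
  have hp : 1 <= eps * ln ((relsize R n NM.1)^-1) by apply: lnp => //; lra.
  have hq : 1 <= eps * ln ((relsize R m NM.2)^-1) by apply: lnp => //; lra.
  have lp : 0 < ln ((relsize R n NM.1)^-1).
    by rewrite -(pmulr_rgt0 _ eps0) (lt_le_trans _ hp).
  have lq : 0 < ln ((relsize R m NM.2)^-1).
    by rewrite -(pmulr_rgt0 _ eps0) (lt_le_trans _ hq).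
  have LN : 0 <= ln NM.1%:R :> R by rewrite ln_ge0// ler1n.
  have LM : 0 <= ln NM.2%:R :> R by rewrite ln_ge0// ler1n.
  have hlN : ln NM.1%:R <= eps * (n%:R * ln ((relsize R n NM.1)^-1)).
    rewrite -ler_pdivrMr ?mulr_gt0//; apply: le_trans (ltW hl).
    by rewrite lerDl divr_ge0// mulr_ge0// ltW.
  have hlM : ln NM.2%:R <= eps * (m%:R * ln ((relsize R m NM.2)^-1)).
    rewrite -ler_pdivrMr ?mulr_gt0//; apply: le_trans (ltW hl).
    by rewrite lerDr divr_ge0// mulr_ge0// ltW.
  rewrite /relsize !invf_div in hp hq hlN hlM lp lq.
  have nN' : (n < NM.1)%N.
    rewrite ltnNge; apply/negP => Nn; move: lp.
    have -> : NM.1 = n by apply/eqP; rewrite eqn_leq Nn nN.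
    by rewrite divff ?gt_eqF// ln1 ltxx.
  have mM' : (m < NM.2)%N.
    rewrite ltnNge; apply/negP => Mm; move: lq.
    have -> : NM.2 = m by apply/eqP; rewrite eqn_leq Mm mM.
    by rewrite divff ?gt_eqF// ln1 ltxx.
  have hd : forall n m, K NM.1 NM.2 (n, m) ->
    1 + dl <= a NM.1 NM.2 n m ^+ 2 * n%:R * m%:R /
      (2 * (n%:R * ln (NM.1%:R / n%:R) + m%:R * ln (NM.2%:R / m%:R))) by near: NM.
  have hV := V_le_signal R NM.1 NM.2 n m (a NM.1 NM.2 n m) eps dl.
  rewrite n0 m0 nN' mM' eps0 eps8 in hV.
  have {}hV := hV isT isT (a_gt0 _ _ _ _ Knm) isT epsd hp hq hlN hlM (hd _ _ Knm).
  have VA : A / eps <= V NM.1 NM.2 R n m.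
    rewrite -ler_sqr ?nnegrE ?V_ge0//; last by rewrite divr_ge0// ltW.
    rewrite V_sqr ?n0 ?m0//.
    have : (A / eps) ^+ 2 / 2 <= ln NM.1%:R by near: NM.
    have : 0 <= ln #|rects NM.1 NM.2 n m|%:R :> R.
      by rewrite ln_ge0// ler1n card_rects_gt0.
    by lra.
  have V0 : 0 < V NM.1 NM.2 R n m by apply: lt_le_trans VA; rewrite divr_gt0.
  apply: le_trans (expect_max_le _ _ _ _ _ _ _ (hxi _ _) n m C
      (a NM.1 NM.2 n m) S n0 m0 CC SC _ _ _ Knm V0 _ hV) _.
    by rewrite mulr_ge0// ltW.
  by rewrite lee_fin; apply: hA; rewrite mulrC -ler_pdivrMr.
near=> NM.
have N0 : (0 < NM.1)%N by near: NM.
have M0 : (0 < NM.2)%N by near: NM.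
have AH : A <= H NM.1 NM.2 by near: NM; exact: Hge.
have t2 : forall S, alt (K NM.1 NM.2) (a NM.1 NM.2) S ->
    (expect (xi NM.1 NM.2) S
      (fun Y => (1 - psi_star (K NM.1 NM.2) (H NM.1 NM.2) Y)%R) <= (e / 3)%:E)%E.
  by near: NM.
have hs : forall n m, K NM.1 NM.2 (n, m) ->
    n%:R^-1 + m%:R^-1 + relsize R n NM.1 + relsize R m NM.2 < e / 3.
  by near: NM; exact: hsize.
have t1 : (expect (xi NM.1 NM.2) 0%R (psi_star (K NM.1 NM.2) (H NM.1 NM.2)) <=
    (e / 3 + e / 3)%:E)%E.
  apply: le_trans (expect_psi_star0_le _ _ _ _ _ _ _ (hxi _ _) _ _ (e / 3) N0 M0
    (K_sub NM.1 NM.2) _ _ _) _.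
  - by apply: le_trans AH; exact: ltW.
  - exact: ltW.
  - move=> n m /hs.
    have : 0 <= n%:R^-1 :> R by rewrite invr_ge0.
    have : 0 <= m%:R^-1 :> R by rewrite invr_ge0.
    have : 0 <= relsize R m NM.2 by rewrite divr_ge0.
    by lra.
  - by rewrite lee_fin lerD2r hA.
have psi_ge0 Y : 0 <= psi_star (K NM.1 NM.2) (H NM.1 NM.2) Y.
  by case/andP: (psi_star01 _ _ _ (K NM.1 NM.2) (H NM.1 NM.2) Y).
have psi_le1 Y : 0 <= 1 - psi_star (K NM.1 NM.2) (H NM.1 NM.2) Y.
  by rewrite subr_ge0; case/andP: (psi_star01 _ _ _ (K NM.1 NM.2) (H NM.1 NM.2) Y).
rewrite /risk; apply/andP; split.
  (* The supremum over an empty alternative would be [-oo], so nonnegativity requires an explicit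
     member [S], built from a size in [K]. *)
  apply: adde_ge0; first by apply: expectation_ge0 => t.
  have [[n m] Knm] := K_neq0 NM.1 NM.2 N0 M0.
  have [/andP[n0 nN] /andP[m0 mM]] := K_sub _ _ _ _ Knm.
  have [C CC] := rects_neq0 _ _ _ _ nN mM.
  pose S : 'M[R]_(NM.1, NM.2) :=
    \matrix_(i, j) if (i, j) \in C then a NM.1 NM.2 n m else 0.
  apply: (@le_trans _ _ (expect (xi NM.1 NM.2) S
      (fun Y => (1 - psi_star (K NM.1 NM.2) (H NM.1 NM.2) Y)%R))).
    by apply: expectation_ge0 => t.
  apply: ereal_sup_ubound; exists S => //; exists (n, m) => //.
  exists C => // i j; rewrite mxE.
  by case: ifPn => [Cij|/negbTE Cij]; split => //; rewrite Cij.
have -> : e = (e / 3 + e / 3) + e / 3 by field.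
rewrite EFinD; apply: leeD => //; apply: ge_ereal_sup => _ [S hS <-].
exact: t2.
Unshelve. all: by end_near.
Qed.
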